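(* Let $n\ge 1$. For every real correlation matrix $P\in M_n(\mathbb{R})$ there is an $n$-tuple of symmetries $S_1,\ldots,S_n$ on a finite-dimensional real Hilbert space such that $P=[\operatorname{tr}(S_i^*S_j)]_{i,j}$.
   Context: A real correlation matrix is a real symmetric positive semidefinite matrix all of whose diagonal entries equal $1$. A symmetry is an operator $S$ with $S^*=S$ and $S^2=I$. $\operatorname{tr}$ is the normalized trace (so $\operatorname{tr}(I)=1$). *)

(* Defs.v *)
From mathcomp Require Import all_boot all_order all_algebra.
From mathcomp Require Import reals.

Set Implicit Arguments.
Unset Strict Implicit.
Unset Printing Implicit Defensive.

Import Order.TTheory GRing.Theory Num.Theory.

Local Open Scope ring_scope.

(* Operators on the real Hilbert space R^d, with its standard inner product,
   are identified with their matrices in the standard basis; the adjoint of an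
   operator is then the transpose of its matrix. *)

Definition psdmx (R : realType) (n : nat) (A : 'M[R]_n) : Prop :=
  A^T = A /\ forall x : 'cV[R]_n, 0 <= (x^T *m A *m x) 0 0.

Definition correlation_mx (R : realType) (n : nat) (P : 'M[R]_n) : Prop :=
  psdmx P /\ forall i : 'I_n, P i i = 1.

Definition symmetry (R : realType) (d : nat) (S : 'M[R]_d) : Prop :=
  S^T = S /\ S *m S = 1%:M.

Definition ntr (R : realType) (d : nat) (A : 'M[R]_d) : R := \tr A / d%:R.

(* Main.v *)
Require Import Defs.
From mathcomp Require Import all_boot all_order all_algebra.
From mathcomp Require Import reals.
From mathcomp Require Import ring.

(** Factor [P = X X^T] by successive Schur complements, so that [P] is the Gram
    matrix of unit vectors, the rows of [X]. The Clifford map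
    [E (t, x) = [t, E x; E x, - t]] sends each vector [x] to a symmetric matrix
    with [E x ^ 2 = |x| ^ 2] and normalized trace [tr (E x * E y) = <x, y>];
    the symmetries are the images of the rows of [X]. *)

Set Implicit Arguments.
Unset Strict Implicit.
Unset Printing Implicit Defensive.

Import Order.TTheory GRing.Theory Num.Theory.

Local Open Scope ring_scope.

Lemma trmx_mx11 (R : nzRingType) (A : 'M[R]_1) : A^T = A.
Proof. by apply/matrixP => i j; rewrite mxE !ord1. Qed.

(** Written as a polynomial in the first coordinate [t], so that positivity can be exploited by a
    good choice of [t]. *)
Lemma quad_block (R : comNzRingType) (n : nat) (a t : R) (b : 'rV[R]_n)
    (C : 'M[R]_n) (y : 'cV[R]_n) :
  ((col_mx t%:M y)^T *m block_mx a%:M b b^T C *m col_mx t%:M y) 0 0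
  = a * t ^+ 2 + t * (b *m y) 0 0 *+ 2 + (y^T *m C *m y) 0 0.
Proof.
rewrite tr_col_mx tr_scalar_mx mul_row_block mul_row_col !mulmxDl.
rewrite !mul_mx_scalar !mul_scalar_mx -!scalemxAl !mxE.
have -> : \sum_j y^T 0 j * b^T j 0 = (b *m y) 0 0.
  by rewrite -[b *m y]trmx_mx11 trmx_mul mxE.
by rewrite !mxE eqxx mulr1n; ring.
Qed.

Lemma psdmx_block (R : realType) (n : nat) (A : 'M[R]_(1 + n)) :
  psdmx A -> exists (a : R) (b : 'rV[R]_n) (C : 'M[R]_n),
    A = block_mx a%:M b b^T C.
Proof.
case=> symA _; exists (A 0 0), (ursubmx A), (drsubmx A).
rewrite -[LHS]submxK trmx_ursub symA; congr block_mx.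
by rewrite [LHS]mx11_scalar !mxE !lshift0.
Qed.

(** On the vectors [(t, b^T)] the form is affine in [t] with slope [2 |b|^2], hence unbounded below
    unless [b = 0]. *)
Lemma psdmx_corner_eq0 (R : realType) (n : nat) (b : 'rV[R]_n) (C : 'M[R]_n) :
  psdmx (block_mx (0%:M : 'M_1) b b^T C) -> b = 0.
Proof.
case=> _ pos.
have sq : (b *m b^T) 0 0 = \sum_j b 0 j ^+ 2.
  by rewrite mxE; apply: eq_bigr => j _; rewrite mxE.
have s0 : (b *m b^T) 0 0 = 0.
  apply/eqP; case: eqVneq => // sN0; set s := _ 0 0 in sN0 *.
  set c := ((b^T)^T *m C *m b^T) 0 0.
  (* This [t] solves [2 t s + c = -1]. *)
  have := pos (col_mx (- (c + 1) / (s *+ 2))%:M b^T).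
  rewrite quad_block -/s -/c mul0r add0r -mulrnAr mulfVK ?mulrn_eq0 //.
  by rewrite opprD addrAC addNr sub0r oppr_ge0 ler10.
apply/rowP => j; rewrite mxE; apply/eqP; rewrite -sqrf_eq0.
move/eqP: s0; rewrite sq psumr_eq0 => [/allP/(_ j (mem_index_enum _))|k _] //.
exact: sqr_ge0.
Qed.

(* For [a = 0] the convention [0^-1 = 0] makes the complement just [C]. *)
Lemma psdmx_schur (R : realType) (n : nat) (a : R) (b : 'rV[R]_n)
    (C : 'M[R]_n) :
  psdmx (block_mx a%:M b b^T C) -> 0 <= a /\ psdmx (C - a^-1 *: (b^T *m b)).
Proof.
case=> sym pos; split.
  have := pos (col_mx 1%:M 0).
  by rewrite quad_block !mulmx0 !mxE expr1n mulr1 mulr0 mul0rn !addr0.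
split.
  move: sym; rewrite tr_block_mx => /eq_block_mx[_ _ _ symC].
  by rewrite linearB /= linearZ /= trmx_mul trmxK symC.
(* Completing the square: for [a > 0] this first coordinate minimizes the form at fixed [y], and the
   minimum is the form of the Schur complement. *)
move=> y; have := pos (col_mx (- a^-1 * (b *m y) 0 0)%:M y).
rewrite quad_block.
set u := b *m y; set c := y^T *m C *m y.
have -> : y^T *m (C - a^-1 *: (b^T *m b)) *m y = c - a^-1 *: (u *m u).
  rewrite mulmxBr mulmxBl -scalemxAr -scalemxAl.
  by rewrite mulmxA -trmx_mul trmx_mx11 -(mulmxA _ b).
have -> (v w : 'M[R]_1) :
    (w - a^-1 *: (v *m v)) 0 0 = w 0 0 - a^-1 * v 0 0 ^+ 2.
  by rewrite !mxE big_ord1.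
suff -> : a * (- a^-1 * u 0 0) ^+ 2 + - a^-1 * u 0 0 * u 0 0 *+ 2 + c 0 0
    = c 0 0 - a^-1 * u 0 0 ^+ 2 by [].
have [->|aN0] := eqVneq a 0; first by rewrite invr0; ring.
by field.
Qed.

(** Cholesky factorization by induction on [n]: [Y] factors the Schur complement, and a first column
    [(r, r^-1 b^T)] with [r ^ 2 = a] restores the rest. *)
Lemma psdmx_gram (R : realType) (n : nat) (A : 'M[R]_n) :
  psdmx A -> exists X : 'M[R]_n, A = X *m X^T.
Proof.
elim: n A => [|n IHn] A psdA; first by exists 0; apply/matrixP => -[].
have [a [b [C eqA]]] := @psdmx_block R n A psdA.
move: psdA; rewrite eqA => psdA.
have [a_ge0 /IHn[Y eqY]] := psdmx_schur psdA.
have b0 : a = 0 -> b = 0.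
  by move=> a0; apply: (@psdmx_corner_eq0 _ _ b C); rewrite -a0.
pose r := Num.sqrt a; have rr : r * r = a by rewrite -expr2 sqr_sqrtr.
(* A zero pivot is harmless: if [r = 0] then [a = 0], and the blocks to be rescaled, [b] and [b^T],
   vanish. *)
have rV m k (M : 'M[R]_(m, k)) : (a = 0 -> M = 0) -> r *: (r^-1 *: M) = M.
  have [r0 M0|rN0 _] := eqVneq r 0; last by rewrite scalerA mulfV // scale1r.
  by rewrite M0 ?scaler0 // -rr r0 mul0r.
exists (block_mx (r%:M : 'M_1) 0 (r^-1 *: b^T) Y : 'M_(1 + n)).
rewrite (@tr_block_mx _ 1 n 1 n) (@mulmx_block _ 1 n 1 n 1 n).
rewrite !trmx0 !mulmx0 !mul0mx !addr0 linearZ /= trmxK tr_scalar_mx.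
rewrite -scalar_mxM rr mul_scalar_mx mul_mx_scalar.
rewrite (rV _ _ b b0) (rV _ _ b^T); last by move=> /b0->; rewrite trmx0.
by rewrite -scalemxAl -scalemxAr scalerA -invfM rr -eqY addrC subrK.
Qed.

(** Induction on [m], doubling [d]. In the square, the off-diagonal blocks [t E x - E x t] cancel
    and both diagonal blocks are [t ^ 2 + E x ^ 2]. In a product, each diagonal block contributes
    the same trace. *)
Lemma clifford_map (R : comNzRingType) (m : nat) :
  exists (d : nat) (E : 'rV[R]_m -> 'M[R]_d),
    [/\ (0 < d)%N,
        forall x, (E x)^T = E x,
        forall x, E x *m E x = ((x *m x^T) 0 0)%:M &
        forall x y, \tr (E x *m E y) = (x *m y^T) 0 0 * d%:R].
Proof.
elim: m => [|m [d [E [d_gt0 symE sqE trE]]]].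
  (* Size 1 rather than 0 keeps [d] positive, as normalizing the trace requires. *)
  exists 1, (fun=> 0); split=> // [x|x|x y]; rewrite ?trmx0 // mulmx0.
    by rewrite mxE big_ord0 raddf0.
  by rewrite mxE big_ord0 mul0r mxtrace0.
have dotE (x y : 'rV[R]_(1 + m)) :
    (x *m y^T) 0 0 = x 0 0 * y 0 0 + (rsubmx x *m (rsubmx y)^T) 0 0.
  rewrite !mxE big_split_ord big_ord1 !mxE !lshift0.
  by congr (_ + _); apply: eq_bigr => j _; rewrite !mxE.
exists (d + d)%N, (fun x : 'rV[R]_(1 + m) =>
  block_mx (x 0 0)%:M (E (rsubmx x)) (E (rsubmx x)) (- (x 0 0))%:M).
split=> [|x|x|x y]; first by rewrite addn_gt0 d_gt0.
- by rewrite tr_block_mx !tr_scalar_mx symE.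
- rewrite mulmx_block dotE sqE -!scalar_mxM mulrNN -!raddfD /=.
  rewrite !mul_scalar_mx !mul_mx_scalar -!scalerDl subrr scale0r.
  by rewrite [X in block_mx _ _ _ X%:M]addrC -scalar_mx_block.
- rewrite mulmx_block mxtrace_block !mxtraceD trE -!scalar_mxM !mxtrace_scalar.
  by rewrite dotE natrD -!(mulr_natr (_ * _)); ring.
Qed.

Theorem theorem13 (R : realType) (n : nat) (hn : (1 <= n)%N) (P : 'M[R]_n)
    (hP : correlation_mx P) :
  exists (d : nat) (S : 'I_n -> 'M[R]_d),
    [/\ (0 < d)%N,
        forall i, symmetry (S i) &
        P = \matrix_(i, j) ntr ((S i)^T *m S j)].
Proof.
have [/psdmx_gram[X eqP] diagP] := hP.
have [d [E [d_gt0 symE sqE trE]]] := clifford_map R n.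
have dotX i j : (row i X *m (row j X)^T) 0 0 = P i j.
  by rewrite eqP !mxE; apply: eq_bigr => k _; rewrite !mxE.
exists d, (fun i => E (row i X)); split=> // [i|].
  (* The unit diagonal of [P] says that the rows of [X] have norm 1, so their images square to the
     identity. *)
  by split; [exact: symE | rewrite sqE dotX diagP].
apply/matrixP => i j; rewrite mxE /ntr symE trE dotX mulfK //.
by rewrite pnatr_eq0 -lt0n.
Qed.
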